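(* Let $p$ be a prime, let $G$ be a finite $p$-group, and let $n, k$ be integers with $n \leq k+1$. Suppose that (1) there exist two proper subgroups $H_1, H_2$ of $G$ such that every element $x \in G$ with $b(x) \geq n$ lies in $H_1 \cup H_2$, and (2) $G$ is generated by the set of elements $x \in G$ with $b(x) \leq k$. Then $\log_p |G'| \leq \frac{(n-1)(n-2)}{2} + k$.
   Context: $G'$ denotes the derived subgroup of $G$. For $x$ in a finite $p$-group $G$, the breadth $b(x)$ is defined by $|G : C_G(x)| = p^{b(x)}$, where $C_G(x)$ is the centralizer of $x$ in $G$. *)

(* Defs.v *)
From mathcomp Require Import all_boot all_order all_algebra all_fingroup all_solvable.
Set Implicit Arguments. Unset Strict Implicit. Unset Printing Implicit Defensive.

(* Breadth of x in G (for a p-group G): |G : C_G(x)| = p ^ breadth p G x. *)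
Definition breadth (p : nat) (gT : finGroupType) (G : {set gT}) (x : gT) : nat :=
  logn p #|G : 'C_G[x]|%g.

(* Main.v *)
Require Import Defs.
From mathcomp Require Import all_boot all_order all_algebra all_fingroup all_solvable.
From mathcomp Require Import zify ring.
Set Implicit Arguments. Unset Strict Implicit. Unset Printing Implicit Defensive.
Import Order.TTheory GRing.Theory Num.Theory.
Local Open Scope group_scope.

(** Put m = n - 1 and induct on |G|.  Choose a maximal subgroup M meeting
    H1 u H2 inside a single proper subgroup A of M, and v outside M of breadth
    at most k; let D be the centralizer in M of v modulo M'.  Since G / M' has
    the abelian normal subgroup M / M', |G' : M'| <= |M : D| <= p^k.  If some
    g outside M centralizes x in M, then v = u g^j with u in M, whence [x, v]
    is a conjugate of [x, u] and x lies in D.  So elements of M outside D have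
    strictly smaller breadth in M than in G, and M satisfies the hypotheses for
    m - 1 with exceptional subgroups A and D.  If D = M then G' = M' and the
    parameters m, k are kept.  The complement of A u D may fail to generate M,
    but then M is a union of three proper subgroups, so |M : D| = 2, and the
    loss in the generation hypothesis is compensated by that small index. *)

(** * Coverings of a group by proper subgroups *)

Lemma proper_pair_avoid (gT : finGroupType) (G A B : {group gT}) :
    A \proper G -> B \proper G ->
  exists x, [/\ x \in G, x \notin A & x \notin B].
Proof.
move=> /properP[sAG [a Ga A'a]] /properP[sBG [b Gb B'b]].
case Ba: (a \in B); last by exists a; rewrite Ba.
case Ab: (b \in A); last by exists b; rewrite Ab.
exists (a * b); split; first exact: groupM.
  by rewrite groupMr.
by rewrite groupMl.
Qed.

(** [A] and [B] have density at most 1/2 and |A :&: B| >= |A||B|/|G|, so [A :|: B] has density at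
    most 3/4. As [C] shares 1 with this union, its density exceeds 1/4. *)
Lemma index_triple_cover (gT : finGroupType) (G A B C : {group gT}) :
    A \proper G -> B \proper G -> C \subset G -> G \subset A :|: B :|: C ->
  (#|G : C| < 4)%N.
Proof.
move=> pA pB sCG cov.
have [sAG sBG] := (proper_sub pA, proper_sub pB).
have half (H : {group gT}) : H \proper G -> (2 * #|H| <= #|G|)%N.
  move=> pH; rewrite -(Lagrange (proper_sub pH)) mulnC leq_mul2l.
  by rewrite indexg_gt1 proper_subn ?orbT.
have hA := half A pA; have hB := half B pB.
have hI : (#|A| * #|B| <= #|G| * #|A :&: B|)%N.
  by rewrite mul_cardG leq_mul2r subset_leq_card ?orbT // mul_subG.
have hU := cardsUI A B.
have hUC := cardsUI (A :|: B) C.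
have hG := subset_leq_card cov.
have hI1 : (0 < #|(A :|: B) :&: C|)%N.
  by apply/card_gt0P; exists 1; rewrite !inE !group1.
have hL := Lagrange sCG.
have hC := cardG_gt0 C; have hG0 := cardG_gt0 G.
rewrite ltnNge; apply/negP=> i4.
have hC4 : (4 * #|C| <= #|G|)%N by rewrite -hL mulnC leq_mul2l i4 orbT.
move: hI hU hUC hG hI1 hC4 hA hB hC hG0; clear.
by nia.
Qed.

(** * Derived subgroups of extensions by a cyclic group *)

(** On the abelian group [N] the map x -> [w, x] is a homomorphism, so its image [R] is a subgroup.
    Modulo [R], [w] centralizes [N], hence [R] contains the derived subgroup; and [R] is a translate
    of the class of [w] under [N]. *)
Lemma card_der1_abelian_cycle (gT : finGroupType) (N : {group gT}) (w : gT) :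
    abelian N -> w \in 'N(N) ->
  (#|(N <*> <[w]>)^`(1)| <= #|N : 'C_N[w]|)%N.
Proof.
move=> abN nNw; pose R := [set [~ w, x] | x in N].
have sRN : R \subset N.
  apply/subsetP=> _ /imsetP[x Nx ->].
  by rewrite commgEr groupM // memJ_norm ?groupV.
have gR : group_set R.
  apply/group_setP; split=> [|_ _ /imsetP[x Nx ->] /imsetP[y Ny ->]].
    by apply/imsetP; exists 1; rewrite ?comm1g ?commg1.
  apply/imsetP; exists (y * x); first exact: groupM.
  rewrite commgMJ; congr (_ * _); apply/esym/conjg_fixP/commgP.
  by apply: (centsP abN) => //; apply: (subsetP sRN); apply: imset_f.
pose R_ := Group gR.
have nRN : N \subset 'N(R_) by apply: cents_norm; rewrite (subset_trans abN) ?centS.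
have nRw : w \in 'N(R_).
  rewrite inE; apply/subsetP=> _ /imsetP[_ /imsetP[x Nx ->] ->].
  apply/imsetP; exists (x ^ w); first by rewrite memJ_norm.
  by rewrite conjRg (conjgE w w) mulKg.
have nRG : N <*> <[w]> \subset 'N(R_) by rewrite join_subG nRN cycle_subG.
have abQ : abelian ((N <*> <[w]>) / R_).
  rewrite quotientY // ?cycle_subG // abelianY.
  rewrite quotient_cycle // cycle_abelian centsC cent_cycle.
  apply/and3P; split=> //; first exact: quotient_abelian.
  apply/subsetP=> _ /morphimP[x nRx Nx ->]; apply/cent1P/esym/commgP.
  by apply/eqP; rewrite -morphR //=; apply: coset_id; apply: imset_f.
apply: leq_trans (subset_leq_card (der1_min nRG abQ)) _.
rewrite index_cent1 -(card_lcoset (w ^: N) w^-1) subset_leq_card //.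
by apply/subsetP=> _ /imsetP[x Nx ->]; rewrite mem_lcoset invgK commgEl mulKVg
  memJ_class.
Qed.

(** This is the subgroup D of the overview; as a preimage of a centralizer it is a group by
    construction. *)
Definition der1_stab (gT : finGroupType) (M : {group gT}) (v : gT) : {group gT} :=
  (M :&: coset M^`(1) @*^-1 'C[coset M^`(1) v])%G.

Lemma mem_der1_stab (gT : finGroupType) (M : {group gT}) (v x : gT) :
  v \in 'N(M) -> x \in M -> (x \in der1_stab M v) = ([~ x, v] \in M^`(1)).
Proof.
move=> nMv Mx.
have nDv : v \in 'N(M^`(1)) by apply: (subsetP (gFnorm_trans _ (subxx _))).
have nDx : x \in 'N(M^`(1)) by apply: (subsetP (der_norm 1 M)).
rewrite inE Mx /= inE nDx /= inE cent1C.
apply/cent1P/idP => [cxv|].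
  by apply: coset_idr; [exact: groupR | rewrite morphR //; apply/eqP/commgP/esym].
by move/coset_id => e; apply/esym/commgP/eqP; rewrite -morphR.
Qed.

Lemma card_der1_normal_cycle (gT : finGroupType) (G M : {group gT}) (v : gT) :
    M <| G -> v \in G -> M <*> <[v]> = G ->
  (#|G^`(1)| <= #|M : der1_stab M v| * #|M^`(1)|)%N.
Proof.
move=> nsMG Gv defG.
have [sMG nMG] := andP nsMG.
have nMv := subsetP nMG v Gv.
have nDG : G \subset 'N(M^`(1)) by apply: gFnorm_trans.
have nDv := subsetP nDG v Gv.
have nDM := der_norm 1 M.
have sDD : M^`(1) \subset G^`(1) by apply: dergS.
rewrite -(Lagrange sDD) mulnC leq_mul2r; apply/orP; right.
rewrite -card_quotient ?(subset_trans (der_sub 1 G)) //.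
rewrite quotient_der // -{1}defG quotientY ?cycle_subG // quotient_cycle //.
apply: leq_trans (card_der1_abelian_cycle _ _) _.
- exact: sub_der1_abelian.
- by rewrite -cycle_subG -quotient_cycle // quotient_norms // cycle_subG.
have sDS : M^`(1) \subset der1_stab M v.
  apply/subsetP=> x Dx; have Mx := subsetP (der_sub 1 M) x Dx.
  by rewrite mem_der1_stab // commgEl groupM ?groupV // memJ_norm //.
have sSM : der1_stab M v \subset M by apply: subsetIl.
(* The stabilizer contains M', so its index is unchanged modulo M'. *)
rewrite -(index_quotient_eq _ _ nDM) //.
  apply: dvdn_leq; first exact: indexg_gt0.
  apply: indexgS; rewrite subsetI quotientS //=.
  rewrite (subset_trans (quotientS _ (subsetIr _ _))) //.
  by rewrite cosetpreK.
by rewrite subIset // sDS orbT.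
Qed.

(** * Centralizers and breadth in a maximal subgroup *)

Lemma cent1_sub_maximal (gT : finGroupType) (G M : {group gT}) (v x : gT) :
    M <| G -> maximal M G -> v \in G -> x \in M -> x \notin der1_stab M v ->
  'C_G[x] \subset M.
Proof.
move=> nsMG maxM Gv Mx; apply: contraR => nCM.
have [sMG nMG] := andP nsMG.
have nDG : G \subset 'N(M^`(1)) by apply: gFnorm_trans.
rewrite mem_der1_stab ?(subsetP nMG) //.
have: v \in M * 'C_G[x] by rewrite (mulg_normal_maximal nsMG maxM) ?subsetIl.
case/mulsgP=> u g Mu /setIP[Gg /cent1P cxg] ->.
rewrite commgMJ (eqP (introT commgP _)) ?mul1g; last by [].
by rewrite memJ_norm ?(subsetP nDG) // mem_commg.
Qed.

Lemma p_index (p : nat) (gT : finGroupType) (G H : {group gT}) :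
  p.-group G -> #|G : H| = (p ^ logn p #|G : H|)%N.
Proof.
move=> pG; rewrite -p_part part_pnat_id //.
exact: pnat_dvd (dvdn_indexg _ _) pG.
Qed.

(** Breadth measures class size, and the class under [M] lies in the class under [G]; this also
    applies to the later [v] outside [M]. *)
Lemma leq_breadth (p : nat) (gT : finGroupType) (G M : {group gT}) (x : gT) :
    prime p -> p.-group G -> M \subset G -> (breadth p M x <= breadth p G x)%N.
Proof.
move=> p_pr pG sMG; rewrite /breadth -(leq_exp2l _ _ (prime_gt1 p_pr)).
rewrite -!p_index ?(pgroupS sMG) // !index_cent1.
exact/subset_leq_card/imsetS.
Qed.

Lemma logn_index_der1_stab (p : nat) (gT : finGroupType) (G M : {group gT}) (v : gT) :
    prime p -> p.-group G -> M <| G -> v \in G ->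
  (logn p #|M : der1_stab M v| <= breadth p G v)%N.
Proof.
move=> p_pr pG nsMG Gv; have [sMG nMG] := andP nsMG.
apply: leq_trans (leq_breadth v p_pr pG sMG).
apply: dvdn_leq_log (indexg_gt0 _ _) (indexgS _ _).
apply/subsetP=> x /setIP[Mx /cent1P cxv].
by rewrite mem_der1_stab ?(subsetP nMG) // (eqP (introT commgP cxv)) group1.
Qed.

Lemma breadth_maximal (p : nat) (gT : finGroupType) (G M : {group gT}) (x : gT) :
    prime p -> p.-group G -> maximal M G -> 'C_G[x] \subset M ->
  breadth p G x = (breadth p M x).+1.
Proof.
move=> p_pr pG maxM sCM; have sMG := proper_sub (maxgroupp maxM).
have eC : 'C_M[x] = 'C_G[x].
  by apply/eqP; rewrite eqEsubset setSI //= subsetI sCM subsetIr.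
rewrite /breadth eC -(Lagrange_index sMG sCM) lognM ?indexg_gt0 //.
by rewrite (p_maximal_index pG maxM) logn_prime // eqxx add1n.
Qed.

(** [H1], [H2] and the center cover [G], so the center has index below 4 and the central quotient is
    cyclic. *)
Lemma abelian_of_central_complement (p : nat) (gT : finGroupType)
    (G H1 H2 : {group gT}) :
    prime p -> p.-group G -> H1 \proper G -> H2 \proper G ->
    G :\: (H1 :|: H2) \subset 'Z(G) ->
  abelian G.
Proof.
move=> p_pr pG pH1 pH2 sZ.
have i4 : (#|G : 'Z(G)| < 4)%N.
  apply: (index_triple_cover pH1 pH2 (center_sub G)).
  by rewrite -subDset.
apply: cyclic_center_factor_abelian.
have c4 : (#|G / 'Z(G)| < 4)%N by rewrite card_quotient ?gFnorm.
have := cardG_gt0 (G / 'Z(G)).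
case E: #|G / 'Z(G)| c4 => [|[|[|[|c]]]] // _ _.
- by move/card1_trivg: E => /= ->; apply: cyclic1.
- by apply: prime_cyclic; rewrite E.
- by apply: prime_cyclic; rewrite E.
Qed.

(** Enlarge [H1], [H2] to maximal [K1], [K2] and take [x] outside both. A maximal [M] through [x]
    with [M :&: K2] inside [K1] suffices, with [A] the trace of [K1] on [M]. *)
Lemma exists_maximal_trace (p : nat) (gT : finGroupType) (G H1 H2 : {group gT}) :
    prime p -> p.-group G -> ~~ cyclic G -> H1 \proper G -> H2 \proper G ->
  exists M A : {group gT},
    [/\ maximal M G, A \proper M & M :&: (H1 :|: H2) \subset A].
Proof.
move=> p_pr pG ncG pH1 pH2.
have max_above (H : {group gT}) : H \proper G ->
    exists2 K : {group gT}, maximal K G & H \subset K.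
  move=> pH; have [eH|//] := maximal_exists (proper_sub pH).
  by move: pH; rewrite eH properxx.
have [K1 maxK1 sHK1] := max_above _ pH1.
have [K2 maxK2 sHK2] := max_above _ pH2.
have [x [Gx K1'x K2'x]] := proper_pair_avoid (maxgroupp maxK1) (maxgroupp maxK2).
suff [M [maxM Mx sMK]] : exists M : {group gT},
    [/\ maximal M G, x \in M & M :&: K2 \subset K1].
  exists M, (M :&: K1)%G; split=> //.
    by apply/properP; split; [exact: subsetIl | exists x; rewrite // inE Mx].
  apply/subsetP=> y /setIP[My /setUP[/(subsetP sHK1)|/(subsetP sHK2)] Ky].
    by rewrite inE My.
  by rewrite inE My (subsetP sMK) // inE My.
have [eK | neK] := eqVneq K1 K2.
  have [|M maxM sxM] := max_above <[x]>%G.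
    rewrite properEneq cycle_subG Gx andbT; apply: contra ncG => /eqP <-.
    exact: cycle_cyclic.
  by exists M; rewrite maxM -cycle_subG sxM eK subsetIr.
have card_max (K : {group gT}) : maximal K G -> (p * #|K| = #|G|)%N.
  move=> maxK; rewrite -(Lagrange (proper_sub (maxgroupp maxK))) mulnC.
  by rewrite (p_maximal_index pG maxK).
have card_maxI (K L : {group gT}) : maximal K G -> maximal L G -> ~~ (L \subset K) ->
    (#|K| * #|L| = #|G| * #|K :&: L|)%N.
  move=> maxK maxL nLK; rewrite mul_cardG.
  rewrite (mulg_normal_maximal (p_maximal_normal pG maxK) maxK) //.
  exact: proper_sub (maxgroupp maxL).
have max_pow (K : {group gT}) : maximal K G -> x ^+ p \in K.
  move=> maxK; have nKG := normal_norm (p_maximal_normal pG maxK).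
  have nKx := subsetP nKG x Gx.
  apply: coset_idr; first exact: groupX.
  rewrite morphX //= -(p_maximal_index pG maxK) -card_quotient //.
  by apply: expg_cardG; rewrite mem_quotient.
have max_nsub (K L : {group gT}) : maximal K G -> maximal L G -> K != L -> ~~ (L \subset K).
  move=> maxK maxL neKL; apply: contra neKL => sLK.
  have [_ /(_ K (maxgroupp maxK) sLK) eKL] := maxgroupP maxL.
  by apply/eqP/val_inj.
have nK21 : ~~ (K2 \subset K1) by apply: max_nsub.
have nK12 : ~~ (K1 \subset K2) by apply: max_nsub => //; rewrite eq_sym.
(* If [K1] and [K2] differ, their intersection has index p^2 in [G], and [x] extends it to a
   subgroup that is still proper. *)
pose J := ((K1 :&: K2) <*> <[x]>)%G.
have nIx : <[x]> \subset 'N(K1 :&: K2).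
  rewrite cycle_subG (subsetP (normsI _ _) x Gx) //.
    exact: normal_norm (p_maximal_normal pG maxK1).
  exact: normal_norm (p_maximal_normal pG maxK2).
have sK1G := proper_sub (maxgroupp maxK1).
have pJ : J \proper G.
  rewrite properE join_subG subIset ?sK1G // cycle_subG Gx /=.
  (* If [J] were [G], each [w] in [K1] would be i x^j with x^j in [K1]. When p divides j, x^j also
     lies in [K2]; otherwise x^j generates <[x]>, forcing [x] into [K1]. *)
  apply: contra nK12 => sGJ; apply/subsetP=> w K1w.
  have := subsetP sGJ w (subsetP sK1G w K1w).
  rewrite /J /= norm_joinEr // => /mulsgP[i _ /setIP[K1i K2i] /cycleP[j ->] ew].
  rewrite ew groupM //.
  have [/dvdnP[q ->] | npj] := boolP (p %| j).
    by rewrite mulnC expgM groupX ?max_pow.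
  have cxj : coprime #[x] j.
    have [e ->] := p_natP (mem_p_elt pG Gx).
    by rewrite coprimeXl // prime_coprime.
  have K1xj : x ^+ j \in K1 by rewrite -(groupMl _ K1i) -ew.
  move: cxj; rewrite -generator_coprime => /eqP ex.
  by case/negP: K1'x; rewrite -cycle_subG ex cycle_subG.
have [M maxM sJM] := max_above _ pJ.
move: sJM; rewrite join_subG cycle_subG => /andP[sIM Mx].
exists M; split=> //.
have nK2M : ~~ (K2 \subset M).
  apply: max_nsub => //; apply: contraNneq K2'x => <-; exact: Mx.
have sIM2 : K1 :&: K2 \subset M :&: K2 by rewrite subsetI sIM subsetIr.
suff eI : #|K1 :&: K2| = #|M :&: K2|.
  have /eqP <- : K1 :&: K2 == M :&: K2 by rewrite eqEcard sIM2 eI /=.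
  exact: subsetIl.
(* Both intersections are of two distinct maximal subgroups, so they have equal order. *)
apply/eqP; rewrite -(eqn_pmul2l (cardG_gt0 G)) -!card_maxI //.
by rewrite eqn_pmul2r ?cardG_gt0 // -(eqn_pmul2l (prime_gt0 p_pr)) !card_max.
Qed.

(** * The induction on the group order *)

Lemma logn_der1_bound (p : nat) (gT : finGroupType) (G H1 H2 : {group gT})
    (m k : nat) :
    prime p -> p.-group G -> (m <= k)%N -> H1 \proper G -> H2 \proper G ->
    {in G :\: (H1 :|: H2), forall x, breadth p G x <= m}%N ->
    G \subset <<[set x in G | (breadth p G x <= k)%N]>> ->
  (logn p #|G^`(1)| <= 'C(m, 2) + k)%N.
Proof.
move=> p_pr; have [c] := ubnP #|G|.
elim: c => // c IH in G H1 H2 m k * => ltGc pG le_mk pH1 pH2 bG genG.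
have triv_ab (K : {group gT}) : abelian K -> logn p #|K^`(1)| = 0%N.
  by move/derG1P->; rewrite cards1 logn1.
have [cG | ncG] := boolP (cyclic G); first by rewrite triv_ab ?cyclic_abelian.
have [M [A [maxM pAM sHA]]] := exists_maximal_trace p_pr pG ncG pH1 pH2.
have pMG := maxgroupp maxM; have sMG := proper_sub pMG.
have nsMG := p_maximal_normal pG maxM.
have pM := pgroupS sMG pG.
have ltMc : (#|M| < c)%N by apply: leq_trans (proper_card pMG) _.
have bM : {in M :\: A, forall x, breadth p G x <= m}%N.
  move=> x /setDP[Mx A'x]; apply: bG; rewrite inE (subsetP sMG) // andbT.
  by apply: contra A'x => Hx; apply: (subsetP sHA); rewrite inE Mx.
have bMM : {in M :\: A, forall x, breadth p M x <= m}%N.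
  by move=> x /bM; apply: leq_trans; apply: leq_breadth.
have [v Gv [M'v bv]] : exists2 v, v \in G & v \notin M /\ (breadth p G v <= k)%N.
  have /subsetPn[v] : ~~ ([set x in G | (breadth p G x <= k)%N] \subset M).
    apply: contra (proper_subn pMG) => sSM.
    by apply: subset_trans genG _; rewrite gen_subG.
  by rewrite inE => /andP[Gv bv] M'v; exists v.
pose D := der1_stab M v.
have sDM : D \subset M by apply: subsetIl.
have defG : M <*> <[v]> = G.
  rewrite norm_joinEr ?(mulg_normal_maximal nsMG maxM) ?cycle_subG //.
  by rewrite (subsetP (normal_norm nsMG)).
have le_beta : (logn p #|M : D| <= k)%N.
  exact: leq_trans (logn_index_der1_stab p_pr pG nsMG Gv) bv.
have le_der : (logn p #|G^`(1)| <= logn p #|M : D| + logn p #|M^`(1)|)%N.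
  have := card_der1_normal_cycle nsMG Gv defG; rewrite -/D.
  rewrite (card_pgroup (pgroupS (der_sub 1 G) pG)) (p_index D pM).
  rewrite [in X in _ -> X](p_index D pM).
  rewrite (card_pgroup (pgroupS (der_sub 1 M) pM)) -expnD.
  by rewrite !pfactorK // leq_exp2l ?prime_gt1.
(* The complement of the proper subgroup [A] generates [M]. *)
have genM j : (m <= j)%N -> M \subset <<[set x in M | (breadth p M x <= j)%N]>>.
  move=> le_mj; apply/subsetP=> x Mx.
  have [/properP[_ [a Ma A'a]]] := pAM.
  have memS y : y \in M -> y \notin A -> y \in <<[set x in M | (breadth p M x <= j)%N]>>.
    move=> My A'y; apply: mem_gen; rewrite inE My.
    by apply: leq_trans (bMM _ _) le_mj; rewrite inE A'y.
  case Ax: (x \in A); last by apply: memS; rewrite ?Ax.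
  rewrite -(groupMr _ (memS a Ma A'a)).
  by apply: memS; [exact: groupM | rewrite groupMl].
have [eDM | neDM] := eqVneq (D : {set gT}) M.
  apply: leq_trans le_der _; rewrite eDM indexgg logn1 add0n.
  apply: (IH M A A) => //; last exact: genM.
  by move=> x; rewrite setUid; apply: bMM.
have pDM : D \proper M by rewrite properEneq neDM.
have bMD : {in M :\: (A :|: D), forall x, breadth p M x < m}%N.
  move=> x /setDP[Mx]; rewrite in_setU negb_or => /andP[A'x D'x].
  rewrite -(breadth_maximal p_pr pG maxM) ?bM //; first by rewrite inE A'x.
  exact: cent1_sub_maximal D'x.
(* For m = 0 no element can have breadth below 0, yet the complement of [A] and [D] is nonempty. *)
case: m le_mk bG bM bMM genM bMD => [|m] le_mk bG bM bMM genM bMD.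
  have [x [Mx A'x D'x]] := proper_pair_avoid pAM pDM.
  by have := bMD x; rewrite ltn0 in_setD in_setU negb_or A'x D'x Mx => /(_ isT).
apply: leq_trans le_der _; rewrite binS bin1.
pose S := [set x in M | (breadth p M x <= m)%N].
have [sMS | nMS] := boolP (M \subset <<S>>).
  (* Using [m] for both parameters bounds log |M'| by 'C(m, 2) + m = 'C(m.+1, 2); the index of [D]
     supplies the remaining [k]. *)
  have := IH M A D m m ltMc pM (leqnn m) pAM pDM bMD sMS.
  by move=> le_dM; rewrite addnC leq_add.
have sSM : <<S>> \subset M by rewrite gen_subG; apply/subsetP=> x /setIdP[].
have lt4 : (#|M : D| < 4)%N.
  apply: (@index_triple_cover _ M A <<S>>%G D) => //.
    by rewrite properE sSM.
  apply/subsetP=> x Mx; rewrite !in_setU.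
  have [//|A'x] := boolP (x \in A); have [_|D'x] := boolP (x \in D).
    by rewrite orbT.
  rewrite orbF /= mem_gen // inE Mx; apply: bMD.
  by rewrite in_setD in_setU negb_or A'x D'x.
have beta1 : (logn p #|M : D| <= 1)%N.
  rewrite leqNgt; apply/negP=> lt1; move: lt4; rewrite ltnNge => /negP; apply.
  rewrite (p_index D pM); apply: (@leq_trans (2 ^ 2)) => //.
  apply: leq_trans (leq_pexp2l (prime_gt0 p_pr) lt1).
  by rewrite leq_exp2r ?prime_gt1.
(* The weaker generation bound [m.+1] costs one and the index of [D] at most one more, so the total
   fits once k >= 2, which holds for m > 0. *)
have leM := IH M A D m m.+1 ltMc pM (leqnSn m) pAM pDM bMD (genM _ (leqnn _)).
have [m0 | m_gt0] := posnP m; last first.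
  by move: beta1 leM le_mk m_gt0; clear; lia.
(* For m = 0 that estimate can be one too large; but then elements of [M] outside [A] and [D] are
   central, so [M] is abelian. *)
rewrite (triv_ab M); first by move: beta1 le_mk; clear; lia.
apply: (abelian_of_central_complement p_pr pM pAM pDM).
apply/subsetP=> x MADx; have := bMD x MADx.
have [Mx _] := setDP MADx.
rewrite m0 ltnS leqn0 => /eqP b0.
have := p_index 'C_M[x] pM; rewrite -/(breadth p M x) b0 expn0.
move/eqP; rewrite indexg_eq1 subsetI => /andP[_ sMC].
by rewrite inE Mx -sub_cent1.
Qed.

Local Open Scope ring_scope.

Theorem theorem2p1 (p : nat) (gT : finGroupType) (G : {group gT}) (n k : int) :
  prime p -> (p.-group G)%g -> n <= k + 1 ->
  (exists H1 H2 : {group gT},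
      [/\ (H1 \proper G)%g, (H2 \proper G)%g &
          forall x, x \in G -> n <= (breadth p G x)%:Z -> (x \in H1) || (x \in H2)]) ->
  (G :=: <<[set x in G | (breadth p G x)%:Z <= k]>>)%g ->
  (logn p #|[~: G, G]%g|)%:Q <= ((n - 1) * (n - 2))%:~R / 2 + k%:~R.
Proof.
move=> p_pr pG le_nk [H1 [H2 [pH1 pH2 bG]]] genG.
(* An element avoiding [H1] and [H2] has breadth below [n], so [n] is positive and [k] nonnegative;
   both can be read as naturals. *)
have n_gt0 : 1 <= n.
  have [x [Gx H1'x H2'x]] := proper_pair_avoid pH1 pH2.
  rewrite leNgt; apply/negP=> n0; have := bG x Gx.
  rewrite (negPf H1'x) (negPf H2'x) => /(_ _)/notF; apply.
  by lia.
case: n => // n in le_nk bG n_gt0 *; case: n => // m in le_nk bG n_gt0 *.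
case: k => // k in le_nk genG *; last by lia.
have le_mk : (m <= k)%N by lia.
have bound : (logn p #|G^`(1)%g| <= 'C(m, 2) + k)%N.
  apply: (@logn_der1_bound p gT G H1 H2) => //; last by rewrite {1}genG.
  move=> x /setDP[Gx]; rewrite inE; apply: contraR; rewrite -ltnNge => ltmb.
  by apply: bG.
have e2 : ((m.+1%:Z - 1) * (m.+1%:Z - 2))%:~R / 2 = ('C(m, 2))%:R :> rat.
  rewrite rmorphM /= !rmorphB /= -[(m.+1%:Z)%:~R]/(m.+1%:R) -natr1.
  rewrite -[1%:~R]/(1 : rat) -[2%:~R]/(2 : rat).
  elim: m {le_nk bG n_gt0 le_mk bound} => [|m IHm]; first by rewrite bin_small //; field.
  by rewrite binS bin1 natrD -IHm -natr1; field.
rewrite e2 -[k%:Z%:~R]/(k%:R) -natrD.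
by rewrite -[X in X <= _]/((logn p _)%:R) ler_nat.
Qed.
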